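(* Let $N\ge 2$, let $\Omega\subset\mathbb{R}^N$ be a bounded and smooth domain, and let $p>N$. Let $\Lambda_p(\Omega):=\lim_{q\to\infty}\lambda_q(\Omega)$. Then $$\Lambda_p(\Omega)=\inf\left\{\|\nabla u\|_p^p : u\in W_0^{1,p}(\Omega)\text{ and }\|u\|_\infty=1\right\}.$$
   Context: A domain is a nonempty connected open set. $\|\cdot\|_s$ denotes the standard norm of $L^s(\Omega)$, $1\le s\le\infty$. For fixed $p>N$ and $q\ge 1$, $$\lambda_q(\Omega):=\inf\left\{\|\nabla u\|_p^p: u\in W_0^{1,p}(\Omega)\text{ and }\|u\|_q=1\right\}.$$ The limit defining $\Lambda_p(\Omega)$ exists, because the function $q\mapsto\lambda_q(\Omega)|\Omega|^{p/q}$ is decreasing ($|\Omega|$ is the Lebesgue measure of $\Omega$). *)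

(* Defs.v *)
From HB Require Import structures.
From mathcomp Require Import all_boot all_order all_algebra.
From mathcomp Require Import all_classical all_reals all_analysis.
From mathcomp Require Import measurable_realfun.

Set Implicit Arguments.
Unset Strict Implicit.
Unset Printing Implicit Defensive.

Import Order.TTheory GRing.Theory Num.Theory.
Import numFieldNormedType.Exports.

Local Open Scope classical_set_scope.
Local Open Scope ring_scope.

(* R^N is rendered as 'rV[R]_N, with its Borel sigma-algebra. *)

HB.instance Definition _ (R : realType) (m n : nat) :=
  @isMeasurable.Build (sigma_display (@open 'M[R]_(m, n))) 'M[R]_(m, n)
    <<s @open 'M[R]_(m, n) >>
    (@sigma_algebra0 _ setT _) (@sigma_algebraC _ _)
    (@sigma_algebra_bigcup _ setT _).

Lemma measurable_fun_rV d (T : measurableType d) (R : realType) (n : nat)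
    (f : T -> 'rV[R]_n) :
  (forall i, measurable_fun setT (fun x => f x ord0 i)) ->
  measurable_fun setT f.
Proof.
move=> mf; apply: (@measurability _ _ _ _ setT f (@open 'rV[R]_n)) => //.
move=> _ [U oU <-]; rewrite setTI.
pose c (q : 'rV[rat]_n) : 'rV[R]_n := map_mx ratr q.
pose B (qk : 'rV[rat]_n * nat) : set 'rV[R]_n := ball (c qk.1) qk.2.+1%:R^-1.
have -> : f @^-1` U = \bigcup_(qk in [set qk | B qk `<=` U]) (f @^-1` B qk).
  apply/seteqP; split=> [x Ufx|x [qk BU Bx]]; last exact: BU.
  have /nbhs_ballP[e /= e0 eU] : nbhs (f x) U by exact: open_nbhs_nbhs.
  have e20 : 0 < e / 2 by rewrite divr_gt0.
  have [k /= ke] : exists k : nat, k.+1%:R^-1 < e / 2.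
    have [k _ /(_ k (leqnn k)) /= kk] :=
      near_infty_natSinv_lt (PosNum e20).
    by exists k.
  have k0 : 0 < k.+1%:R^-1 :> R by rewrite invr_gt0.
  have /choice[q qP] : forall i : 'I_n, exists q : rat,
      ratr q \in `]f x ord0 i, f x ord0 i + k.+1%:R^-1[.
    by move=> i; apply: rat_in_itvoo; rewrite ltrDl.
  have Bfx : ball (c (\row_i q i)) k.+1%:R^-1 (f x).
    split => // i j; rewrite !mxE (ord1 i).
    have := qP j; rewrite in_itv/= => /andP[h1 h2].
    by rewrite /ball/= gtr0_norm ?subr_gt0// ltrBlDl.
  exists (\row_i q i, k) => // y /= By; apply: eU.
  rewrite [e]splitr; apply: (@ball_triangle _ _ (c (\row_i q i))).
    by apply: ball_sym; apply: le_ball Bfx; exact: ltW.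
  by apply: le_ball By; exact: ltW.
rewrite bigcup_mkcond.
apply: countable_bigcupT_measurable => [|qk]; first exact: countableP.
case: ifPn => // _.
have -> : f @^-1` B qk =
    \bigcap_(i in [set: 'I_n])
      [set x | `|c qk.1 ord0 i - f x ord0 i| < qk.2.+1%:R^-1].
  apply/seteqP; split=> [x [_ Bx] i _|x Bx]; first exact: Bx.
  by split=> [|j i]; [rewrite invr_gt0|rewrite (ord1 j); exact: Bx].
apply: fin_bigcap_measurable => [|i _]; first exact: finite_finset.
have mh : measurable_fun setT (fun x => `|c qk.1 ord0 i - f x ord0 i|).
  by apply: measurableT_comp => //; exact: measurable_funB.
rewrite -[X in measurable X]setTI.
have -> : [set x | `|c qk.1 ord0 i - f x ord0 i| < qk.2.+1%:R^-1] =
    (fun x => `|c qk.1 ord0 i - f x ord0 i|) @^-1` `]-oo, qk.2.+1%:R^-1[.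
  by apply/seteqP; split => x /=; rewrite in_itv.
exact: mh.
Qed.

Lemma measurable_coord_rV (R : realType) (n : nat) (i : 'I_n) :
  measurable_fun setT (fun v : 'rV[R]_n => v ord0 i).
Proof.
apply: (measurability _ (RGenOpens.measurableE R)) => _ [_ [a [b ->]] <-].
rewrite setTI; apply: sub_sigma_algebra.
apply: open_comp; last exact: interval_open.
by move=> v _; exact: coord_continuous.
Qed.

Section lebesgue_measure_rV.
Variable R : realType.

Definition cons_rV (n : nat) (xt : 'rV[R]_n * R) : 'rV[R]_n.+1 :=
  row_mx (xt.2%:M : 'M[R]_1) xt.1.

Lemma measurable_cons_rV (n : nat) : measurable_fun setT (@cons_rV n).
Proof.
apply: measurable_fun_rV => i.
have [j|j] := split_ordP (i : 'I_(1 + n)) => ->.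
  rewrite (_ : (fun _ => _) = snd); first exact: measurable_snd.
  apply/funext => x; rewrite /cons_rV; etransitivity; first exact: row_mxEl.
  by rewrite mxE (ord1 j) eqxx mulr1n.
rewrite (_ : (fun _ => _) = (fun x : 'rV[R]_n * R => x.1 ord0 j)); last first.
  by apply/funext => x; rewrite /cons_rV; exact: row_mxEr.
exact: measurableT_comp (measurable_coord_rV j) measurable_fst.
Qed.

Section cons_measure.
Variables (n : nat) (m : {measure set 'rV[R]_n -> \bar R}).

Definition cons_measure : set 'rV[R]_n.+1 -> \bar R :=
  pushforward (m \x lebesgue_measure)%E (@cons_rV n).

Let cons_pushforward : {measure set 'rV[R]_n.+1 -> \bar R} :=
  measure_function_pushforward__canonical__measure_function_Measure
    (m \x lebesgue_measure)%E (@measurable_cons_rV n).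

HB.instance Definition _ := isMeasure.Build _ _ _ cons_measure
  (@measure0 _ _ _ cons_pushforward) (@measure_ge0 _ _ _ cons_pushforward)
  (@measure_semi_sigma_additive _ _ _ cons_pushforward).

End cons_measure.

(* Iterated product of the one-dimensional Lebesgue measure; R^0 is a single
   point of mass 1. *)
Fixpoint lebesgue_rV (n : nat) : {measure set 'rV[R]_n -> \bar R} :=
  match n with
  | 0 => dirac (0 : 'rV[R]_0)
  | n'.+1 => cons_measure (lebesgue_rV n')
  end.

End lebesgue_measure_rV.

Section smooth.
Context {R : realType} {N : nat}.
Implicit Types (f : 'rV[R]_N -> R) (Omega : set 'rV[R]_N).

Definition partial (i : 'I_N) f : 'rV[R]_N -> R :=
  fun x => 'D_(delta_mx ord0 i) f x.

Definition gradient f : 'rV[R]_N -> 'rV[R]_N :=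
  fun x => \row_i partial i f x.

(* C^oo: all iterated partial derivatives are differentiable everywhere (the
   empty list gives f itself). *)
Definition smooth f :=
  forall (s : seq 'I_N) x, differentiable (foldr partial f s) x.

Definition test_function Omega f :=
  [/\ smooth f, compact (closure [set x | f x != 0]) &
      closure [set x | f x != 0] `<=` Omega].

Definition domain Omega := [/\ Omega !=set0, open Omega & connected Omega].

End smooth.

(* Near each boundary point, Omega is the region strictly on one side (chosen
   by b) of the graph of a C^oo function of the N - 1 coordinates other than
   the i-th one. *)
Definition smooth_boundary (R : realType) (N : nat) (Omega : set 'rV[R]_N) :=
  forall x0, (closure Omega `\` interior Omega) x0 ->
  exists (i : 'I_N) (b : bool) (gamma : 'rV[R]_N.-1 -> R) (r : R),
    [/\ 0 < r, smooth gamma &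
        forall x, ball x0 r x ->
          (Omega x <-> 0 < (-1) ^+ b * (x ord0 i - gamma (col' i x)))].

Section sobolev.
Context {R : realType} {N : nat}.
Implicit Types (Omega : set 'rV[R]_N) (u : 'rV[R]_N -> R)
  (g : 'rV[R]_N -> 'rV[R]_N).

(* The library norm `|v| on 'rV is the maximum norm. *)
Definition euclidean_norm (v : 'rV[R]_N) : R :=
  Num.sqrt (\sum_i v ord0 i ^+ 2).

(* The norm of L^s(Omega), 1 <= s <= +oo; u is extended by 0 outside Omega, so
   its values there are irrelevant. *)
Definition Lp_norm Omega (s : \bar R) u : \bar R :=
  ('N[lebesgue_rV R N]_s [EFin \o (u \_ Omega)])%E.

Definition in_Lp Omega (s : \bar R) u :=
  measurable_fun Omega u /\ (Lp_norm Omega s u < +oo)%E.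

Definition weak_gradient Omega u g :=
  forall phi, test_function Omega phi -> forall i,
  (\int[lebesgue_rV R N]_(x in Omega) (u x * partial i phi x)%:E =
   - \int[lebesgue_rV R N]_(x in Omega) (g x ord0 i * phi x)%:E)%E.

(* Elements of W^{1,p}(Omega) come with their gradient: sobolev p Omega u g
   means that u belongs to W^{1,p}(Omega) and that g is its weak gradient
   (which u determines up to a null set). Likewise for sobolev0. *)
Definition sobolev (p : R) Omega u g :=
  [/\ in_Lp Omega p%:E u,
      forall i, in_Lp Omega p%:E (fun x => g x ord0 i) &
      weak_gradient Omega u g].

Definition sobolev_norm (p : R) Omega u g : \bar R :=
  (Lp_norm Omega p%:E u + Lp_norm Omega p%:E (euclidean_norm \o g))%E.

(* W_0^{1,p}(Omega), the closure of the test functions in W^{1,p}(Omega). *)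
Definition sobolev0 (p : R) Omega u g :=
  sobolev p Omega u g /\
  forall e : R, 0 < e -> exists2 phi, test_function Omega phi &
    (sobolev_norm p Omega (u \- phi)%R (g \- gradient phi)%R < e%:E)%E.

(* ||\nabla u||_p^p, as a function of g = \nabla u. *)
Definition energy (p : R) Omega g : \bar R :=
  (Lp_norm Omega p%:E (euclidean_norm \o g) `^ p)%E.

Definition lambda (p : R) Omega (q : R) : \bar R :=
  ereal_inf [set E | exists u g, [/\ sobolev0 p Omega u g,
    Lp_norm Omega q%:E u = 1%E & E = energy p Omega g]].

Definition Lambda (p : R) Omega : \bar R :=
  lim (lambda p Omega q @[q --> +oo%R]).

End sobolev.

(* Main.v *)
From HB Require Import structures.
Require Import Defs.
From mathcomp Require Import all_boot all_order all_algebra.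
From mathcomp Require Import all_classical all_reals all_analysis.
From mathcomp Require Import measurable_realfun ess_sup_inf ring lra.
Import Order.TTheory GRing.Theory Num.Theory.
Import numFieldNormedType.Exports.
Local Open Scope classical_set_scope.
Local Open Scope ring_scope.
Set Implicit Arguments.
Unset Strict Implicit.
Unset Printing Implicit Defensive.

(* Let M be the infimum over ||u||_oo = 1. If V >= |Omega|, then
   ||u||_q <= V^(1/q) ||u||_oo, so dividing u by its sup norm gives
   lambda_q >= V^(-p/q) M. Conversely, if ||u||_oo = 1 and d < 1, then
   ||u||_q >= d |{|u| > d}|^(1/q), so dividing u by ||u||_q gives
   lambda_q <= d^(-p) c^(1/q) ||grad u||_p^p for some c > 0. Letting q -> oo and
   then d -> 1 squeezes lambda_q to M.

   The first inequality needs every u in W_0^{1,p} to be bounded, that is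
   |f(x)| <= C ||grad f||_p for test functions f. Let Q be a unit cube disjoint
   from Omega and F(s) the integral over y in Q of f(x + s^(m+1) (y - x)): then
   F(0) = f(x) and F(1) = 0. The contraction by t = s^(m+1) multiplies Lebesgue
   measure by t^N, so that the integral over Q of |grad f|(x + t (y - x)) is at
   most of the order of t^(-N/p) ||grad f||_p, whence
   |F'(s)| <= const s^(m - (m+1) N/p) ||grad f||_p. As p > N, the exponent of s
   is nonnegative for large m, and the mean value theorem applies to F. *)

(** * Lebesgue measure on R^n *)

Lemma continuous_measurable_rV (R : realType) (n : nat) (f : 'rV[R]_n -> R) :
  continuous f -> measurable_fun setT f.
Proof.
move=> cf; apply: (measurability _ (RGenOpens.measurableE R)) => _ [_ [a [b ->]] <-].
rewrite setTI; apply: sub_sigma_algebra.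
by apply: open_comp; last exact: interval_open.
Qed.

Lemma continuous_measurable_rV_rV (R : realType) (m n : nat)
    (f : 'rV[R]_m -> 'rV[R]_n) :
  continuous f -> measurable_fun setT f.
Proof.
move=> cf; apply: measurable_fun_rV => i; apply: continuous_measurable_rV => x.
exact: (continuous_comp (cf x) (@coord_continuous _ _ _ ord0 i (f x))).
Qed.

Definition box (R : realType) (n : nat) (a b : R) : set 'rV[R]_n :=
  [set v | forall i, v ord0 i \in `[a, b]].
Arguments box {R} n a b.

Lemma measurable_box (R : realType) (n : nat) (a b : R) :
  measurable (box n a b).
Proof.
have -> : box n a b = \bigcap_(i in [set: 'I_n])
    ((fun v : 'rV[R]_n => v ord0 i) @^-1` `[a, b]).
  by apply/seteqP; split => [v bv i _|v bv i]; [exact: bv|exact: (bv i)].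
apply: fin_bigcap_measurable => [|i _]; first exact: finite_finset.
by rewrite -[X in measurable X]setTI; exact: measurable_coord_rV.
Qed.

Lemma cons_rVl (R : realType) (n : nat) (vt : 'rV[R]_n * R) (j : 'I_1) :
  cons_rV vt ord0 (lshift n j) = vt.2.
Proof.
by etransitivity; [exact: row_mxEl|rewrite mxE (ord1 j) eqxx mulr1n].
Qed.

Lemma cons_rVr (R : realType) (n : nat) (vt : 'rV[R]_n * R) (j : 'I_n) :
  cons_rV vt ord0 (rshift 1 j) = vt.1 ord0 j.
Proof. exact: row_mxEr. Qed.

Lemma cons_rV_box (R : realType) (n : nat) (a b : R) :
  cons_rV (n:=n) @^-1` box n.+1 a b = box n a b `*` `[a, b].
Proof.
apply/seteqP; split => [[v t] /= bvt|[v t] /= [bv bt]].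
  split => [i|].
    by have := bvt (rshift 1 i); rewrite cons_rVr.
  by have := bvt (lshift n (ord0 : 'I_1)); rewrite cons_rVl.
move=> i; have [j|j] := split_ordP (i : 'I_(1 + n)) => ->.
  by rewrite cons_rVl.
by rewrite cons_rVr; exact: bv.
Qed.

Lemma lebesgue_rV_box (R : realType) (n : nat) (a b : R) : a <= b ->
  lebesgue_rV R n (box n a b) = ((b - a) ^+ n)%:E.
Proof.
move=> ab; elim: n => [|n IH].
  rewrite /= diracE expr0; case: (boolP (_ \in _)) => //.
  by move=> /negP []; rewrite inE => -[].
rewrite /= /cons_measure /pushforward cons_rV_box.
have := product_measure1E (lebesgue_rV R n) (@lebesgue_measure R)
  (@measurable_box R n a b) (measurable_itv `[a, b]).
rewrite /= => ->.
rewrite IH lebesgue_measure_itv /= lte_fin; case: ltP => [_|ba].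
  by rewrite -EFinD -EFinM exprSr.
have -> : b = a by apply/le_anti; rewrite ab ba.
by rewrite subrr mule0 exprS mul0r.
Qed.

Lemma lebesgue_rV_sigma_finite (R : realType) (n : nat) :
  sigma_finite setT (lebesgue_rV R n).
Proof.
exists (fun k => box n (- k%:R) k%:R).
  apply/seteqP; split => // x _.
  (* The sum of all |x_i| bounds every coordinate at once, so the next integer above it is a
     half-side of a cube containing [x]. *)
  exists (Num.trunc (\sum_i `|x ord0 i|)).+1 => // i.
  have h : `|x ord0 i| < (Num.trunc (\sum_i `|x ord0 i|)).+1%:R.
    apply: le_lt_trans (truncnS_gt _).
    by rewrite (bigD1 i) //= lerDl sumr_ge0.
  by rewrite in_itv /=; move/ltW: h; rewrite ler_norml.
move=> k; split; first exact: measurable_box.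
by rewrite lebesgue_rV_box ?ltry// lerNl (@le_trans _ _ 0)// oppr_le0.
Qed.

(* [lebesgue_rV R n] is a term of the type of bare measures; this copy carries
   the sigma-finite structure that Tonelli's theorem requires. *)
Definition lebesgue_rV_sf (R : realType) (n : nat) : set 'rV[R]_n -> \bar R :=
  lebesgue_rV R n.

HB.instance Definition _ (R : realType) (n : nat) :=
  isMeasure.Build _ _ _ (@lebesgue_rV_sf R n)
    (@measure0 _ _ _ (lebesgue_rV R n)) (@measure_ge0 _ _ _ (lebesgue_rV R n))
    (@measure_semi_sigma_additive _ _ _ (lebesgue_rV R n)).

HB.instance Definition _ (R : realType) (n : nat) :=
  @Measure_isSigmaFinite.Build _ _ _ (@lebesgue_rV_sf R n)
    (@lebesgue_rV_sigma_finite R n).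

(** The measure in dimension n + 1 is the image of a product measure under [cons_rV]: transport the
    integral, then apply Tonelli. This is what makes induction on the dimension possible. *)
Lemma integral_lebesgue_rVS (R : realType) (n : nat) (f : 'rV[R]_n.+1 -> \bar R) :
  measurable_fun setT f -> (forall x, 0 <= f x)%E ->
  (\int[lebesgue_rV R n.+1]_z f z =
   \int[lebesgue_rV R n]_x \int[@lebesgue_measure R]_t f (cons_rV (x, t)))%E.
Proof.
move=> mf f0.
pose m : {measure set ('rV[R]_n * measurableTypeR R)%type -> \bar R} :=
  (lebesgue_rV R n \x lebesgue_measure)%E.
have := @ge0_integral_pushforward _ _ _ _ _ _
  (@measurable_cons_rV R n : measurable_fun setT
    (_ : 'rV[R]_n * measurableTypeR R -> _)) m setT f measurableT mf
  (fun y _ => f0 y).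
rewrite preimage_setT => {}E; etransitivity; first exact: E.
apply: (@fubini_tonelli1 _ _ _ _ R (@lebesgue_rV_sf R n) lebesgue_measure
  (f \o cons_rV (n:=n))) => [|x]; last exact: f0.
by apply: measurableT_comp => //; exact: measurable_cons_rV.
Qed.

(** * Affine changes of variables *)

Lemma lebesgue_measure_affine (R : realType) (a t : R) (A : set R) : 0 < t ->
  measurable A ->
  (lebesgue_measure ((fun y => a + t * y)%R @^-1` A) =
   t^-1%:E * lebesgue_measure A)%E.
Proof.
move=> t0 mA.
have mh : measurable_fun setT (fun y : R => a + t * y).
  by apply: measurable_funD => //; apply: measurable_funM.
have ti0 : 0 <= t by exact: ltW.
pose m0 : {measure set (measurableTypeR R) -> \bar R} :=
  measure_function_pushforward__canonical__measure_function_Measure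
    (@lebesgue_measure R) (mh : measurable_fun setT
     (_ : measurableTypeR R -> measurableTypeR R)).
pose m : {measure set (measurableTypeR R) -> \bar R} := mscale (NngNum ti0) m0.
(* [m] is t times the image of Lebesgue measure under y -> a + t y. The two agree on half-open
   intervals, hence everywhere by uniqueness. *)
have E : lebesgue_measure A = m A.
  apply: lebesgue_measure_unique => // _ [[u v]] _ <-.
  rewrite /m /= /mscale /= /m0 /= /pushforward.
  have -> : (fun y => a + t * y) @^-1` `]u, v] =
      `](u - a) / t, (v - a) / t]%classic.
    apply/seteqP; split => y /=; rewrite !in_itv /= ltr_pdivrMr// ler_pdivlMr//
      ltrBlDl lerBrDl (mulrC y); exact.
  rewrite !lebesgue_measure_itv /= !lte_fin ltr_pM2r ?invr_gt0// ltrD2r.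
  case: ifP => // _; last by rewrite mule0.
  by rewrite -!EFinD -EFinM; congr EFin; field; rewrite gt_eqF.
rewrite E /m /= /mscale /= muleA -EFinM mulVf ?gt_eqF// mul1e.
by [].
Qed.

Lemma ge0_integral_affine1 (R : realType) (a t : R) (f : R -> \bar R) : 0 < t ->
  measurable_fun setT f -> (forall x, 0 <= f x)%E ->
  (\int[@lebesgue_measure R]_y f (a + t * y)%R =
   t^-1%:E * \int[@lebesgue_measure R]_y f y)%E.
Proof.
move=> t0 mf f0.
have mh : measurable_fun setT (fun y : R => a + t * y).
  by apply: measurable_funD => //; apply: measurable_funM.
have ti0 : 0 <= t^-1 by rewrite invr_ge0 ltW.
have := @ge0_integral_pushforward _ _ _ _ _
  ((fun y => a + t * y) : measurableTypeR R -> measurableTypeR R) mh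
  (@lebesgue_measure R) setT f measurableT mf (fun y _ => f0 y).
rewrite preimage_setT => /esym E; etransitivity; first exact: E.
rewrite -(@ge0_integral_mscale _ _ _ (@lebesgue_measure R) setT measurableT
  (NngNum ti0) f mf (fun x _ => f0 x)).
pose m0 : {measure set (measurableTypeR R) -> \bar R} :=
  measure_function_pushforward__canonical__measure_function_Measure
    (@lebesgue_measure R) (mh : measurable_fun setT
     (_ : measurableTypeR R -> measurableTypeR R)).
apply: (@eq_measure_integral _ _ _ setT (mscale (NngNum ti0) lebesgue_measure)
  m0) => A mA _.
by rewrite /m0 /= /mscale /= /pushforward; exact: lebesgue_measure_affine.
Qed.

Lemma continuous_affine (R : realType) (n : nat) (a : 'rV[R]_n) (t : R) :
  continuous (fun y : 'rV[R]_n => a + t *: y).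
Proof.
move=> y; apply: (@continuousD _ _ _ (fun=> a) (fun y => t *: y)).
  exact: cst_continuous.
exact: scaler_continuous.
Qed.

(** Induction on the dimension: the map acts coordinate by coordinate, so after Tonelli the first
    coordinate yields a factor 1/t and the induction hypothesis handles the others. *)
Lemma ge0_integral_affine (R : realType) (n : nat) (a : 'rV[R]_n) (t : R)
    (f : 'rV[R]_n -> \bar R) : 0 < t ->
  measurable_fun setT f -> (forall x, 0 <= f x)%E ->
  (\int[lebesgue_rV R n]_y f (a + t *: y)%R =
   (t ^- n)%:E * \int[lebesgue_rV R n]_y f y)%E.
Proof.
move=> t0; elim: n a f => [|n IH] a f mf f0.
  rewrite expr0 invr1 mul1e; apply: eq_integral => x _; congr f.
  by apply/rowP => -[].
have mt : measurable_fun setT (fun y : 'rV[R]_n.+1 => a + t *: y).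
  by apply: continuous_measurable_rV_rV; exact: continuous_affine.
rewrite integral_lebesgue_rVS//; last exact: measurableT_comp.
rewrite integral_lebesgue_rVS//.
pose a1 : 'rV[R]_n := \row_i a ord0 (lift ord0 i).
have consE x s : a + t *: cons_rV (x, s) = cons_rV (a1 + t *: x, a ord0 ord0 + t * s).
    apply/rowP => i; rewrite [LHS]mxE [X in _ + X]mxE.
  have [j|j] := split_ordP (i : 'I_(1 + n)) => ->.
    by rewrite !cons_rVl /= (ord1 j); congr (a _ _ + _); exact/val_inj.
  by rewrite !cons_rVr /= !mxE; congr (a _ _ + _); exact/val_inj.
pose g (x : 'rV[R]_n) := (\int[@lebesgue_measure R]_s f (cons_rV (x, s)))%E.
have mfc : measurable_fun setT (f \o cons_rV (n:=n)).
  by apply: measurableT_comp => //; exact: measurable_cons_rV.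
have mg : measurable_fun setT g.
  exact: (measurable_fun_fubini_tonelli_F (m2 := @lebesgue_measure R) _ mfc (fun x => f0 _)).
have g0 x : (0 <= g x)%E by apply: integral_ge0.
transitivity (\int[lebesgue_rV R n]_x (t^-1%:E * g (a1 + t *: x)%R))%E.
  apply: eq_integral => x _; under eq_integral do rewrite consE.
  rewrite (@ge0_integral_affine1 _ _ _ (fun s => f (cons_rV (a1 + t *: x, s))))//.
  exact: (measurableT_comp mfc (measurable_pair1 _)).
rewrite ge0_integralZl_EFin//; last 2 first.
- apply: measurableT_comp mg _.
  by apply: continuous_measurable_rV_rV; exact: continuous_affine.
- by rewrite invr_ge0 ltW.
by rewrite IH// muleA -EFinM exprS invfM.
Qed.

(** * Smooth functions and test functions *)

Lemma smooth_differentiable (R : realType) (N : nat) (f : 'rV[R]_N -> R) x :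
  smooth f -> differentiable f x.
Proof. by move=> /(_ [::] x). Qed.

Lemma smooth_continuous (R : realType) (N : nat) (f : 'rV[R]_N -> R) :
  smooth f -> continuous f.
Proof.
by move=> sf x; apply/differentiable_continuous/smooth_differentiable.
Qed.

(** Differentiating [partial i f] along [s] is differentiating [f] along [rcons s i], since [foldr]
    treats the last index first. *)
Lemma smooth_partial (R : realType) (N : nat) (f : 'rV[R]_N -> R) i :
  smooth f -> smooth (partial i f).
Proof. by move=> sf s x; have := sf (rcons s i) x; rewrite foldr_rcons. Qed.

Lemma diff_partial (R : realType) (N : nat) (f : 'rV[R]_N -> R) x v :
  differentiable f x -> 'd f x v = \sum_i v ord0 i * partial i f x.
Proof.
move=> df; rewrite [in LHS](row_sum_delta v) linear_sum; apply: eq_bigr => i _.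
by rewrite linearZ /= /partial deriveE.
Qed.

(** Chain rule along a segment run through with speed of order s^m. The vanishing of this factor at
    s = 0 later absorbs the singularity created by the contraction towards x. *)
Lemma is_derive_power_path (R : realType) (N m : nat) (f : 'rV[R]_N -> R)
    (a b : 'rV[R]_N) (s : R) :
  (forall x, differentiable f x) ->
  is_derive s 1 (fun r : R => f (a + r ^+ m.+1 *: b))
    (m.+1%:R * s ^+ m * \sum_i b ord0 i * partial i f (a + s ^+ m.+1 *: b)).
Proof.
(* The path [g] and its differential [dg] are written as sums and compositions of functions, the
   shape in which the differentiation rules apply. *)
move=> df; pose g : R -> 'rV[R]_N := (fun=> a) + ( *:%R ^~ b \o (id ^+ m.+1 : R -> R)).
have gE r : g r = a + r ^+ m.+1 *: b.
  by rewrite /g -[LHS]/(_ + _) /= exprfctE.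
pose dg : R -> 'rV[R]_N := 0 + ( *:%R ^~ b \o (m.+1%:R * s ^+ m *: (id : R -> R))).
have isdg : is_diff s g dg by exact: is_diffD.
have -> : (fun r : R => f (a + r ^+ m.+1 *: b)) = f \o g.
  by apply/funext => r /=; rewrite gE.
have dfg : differentiable (f \o g) s by apply: differentiable_comp.
apply: DeriveDef; first exact: diff_derivable.
rewrite deriveE// diff_comp//= diff_val gE.
rewrite diff_partial// mulr_sumr; apply: eq_bigr => i _.
rewrite /dg -[(_ + _) 1]/(_ + _) /= add0r !mxE.
by rewrite -[(_ *: id) 1]/(_ * 1) mulr1 -!mulrA.
Qed.

Lemma euclidean_norm_ge0 (R : realType) (N : nat) (v : 'rV[R]_N) :
  0 <= euclidean_norm v.
Proof. exact: sqrtr_ge0. Qed.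

Lemma ler_coord_euclidean_norm (R : realType) (N : nat) (v : 'rV[R]_N) i :
  `|v ord0 i| <= euclidean_norm v.
Proof.
rewrite -sqrtr_sqr ler_sqrt; last by apply: sumr_ge0 => j _; exact: sqr_ge0.
by rewrite (bigD1 i)//= lerDl; apply: sumr_ge0 => j _; exact: sqr_ge0.
Qed.

Lemma continuous_euclidean_gradient (R : realType) (N : nat)
    (f : 'rV[R]_N -> R) :
  smooth f -> continuous (euclidean_norm \o gradient f).
Proof.
move=> sf; have -> : euclidean_norm \o gradient f =
    Num.sqrt \o (fun x => \sum_i (partial i f x) ^+ 2).
  apply/funext => x /=; congr Num.sqrt; apply: eq_bigr => i _.
  by rewrite mxE.
move=> x; apply: (@continuous_comp _ _ _
  (fun x => \sum_i (partial i f x) ^+ 2) Num.sqrt x); last first.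
  exact: sqrt_continuous.
apply: continuous_big => [|i _ y]; first exact: add_continuous.
apply: (@continuous_comp _ _ _ (partial i f) (fun t => t ^+ 2) y).
  exact/smooth_continuous/smooth_partial.
exact: exprn_continuous.
Qed.

Lemma continuous_compactly_bounded (R : realType) (T : topologicalType)
    (K : set T) (g : T -> R) :
  compact K -> continuous g -> (forall x, ~ K x -> g x = 0) ->
  exists2 M, 0 <= M & forall x, `|g x| <= M.
Proof.
move=> cK cg g0.
have /compact_bounded[M0 [M0r hM]] : compact (g @` K).
  by apply: continuous_compact => //; exact: continuous_subspaceT.
exists (`|M0| + 1) => [|x]; first by rewrite addr_ge0.
have [Kx|/g0 ->] := pselect (K x); last by rewrite normr0 addr_ge0.
apply: (hM (`|M0| + 1)); last by exists x.
by rewrite (le_lt_trans (ler_norm _))// ltrDl.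
Qed.

Lemma eq0_outside_support (R : realType) (N : nat) (f : 'rV[R]_N -> R) x :
  ~ closure [set x | f x != 0] x -> f x = 0.
Proof.
by move=> nc; apply: contrapT => /eqP fx; apply: nc; exact: subset_closure.
Qed.

(** The complement of the support is open, so [f] coincides with the zero function near [x]. *)
Lemma gradient_eq0_outside_support (R : realType) (N : nat) (f : 'rV[R]_N -> R) x :
  ~ closure [set x | f x != 0] x -> gradient f x = 0.
Proof.
move=> nc; apply/rowP => i; rewrite !mxE /partial.
have /open_nbhs_nbhs : open_nbhs x (~` closure [set x | f x != 0]).
  by split => //; apply: closed_openC; exact: closed_closure.
move=> near0; rewrite (@near_eq_derive _ _ _ _ (cst 0)).
  by rewrite derive_cst.
by near=> y; apply: eq0_outside_support; near: y.
Unshelve. all: by end_near. Qed.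

Lemma euclidean_norm0 (R : realType) (N : nat) :
  euclidean_norm (0 : 'rV[R]_N) = 0.
Proof.
by rewrite /euclidean_norm big1 ?sqrtr0// => i _; rewrite mxE expr0n.
Qed.

Lemma test_function_outside (R : realType) (N : nat) (Omega : set 'rV[R]_N)
    (f : 'rV[R]_N -> R) x : test_function Omega f -> ~ Omega x ->
  f x = 0 /\ gradient f x = 0.
Proof.
move=> [_ _ sO] nO.
have nc : ~ closure [set x | f x != 0] x by move=> /sO.
by split; [exact: eq0_outside_support|exact: gradient_eq0_outside_support].
Qed.

(** Supplies the constants that justify integrability and differentiation under the integral sign;
    their value never enters the final estimate. *)
Lemma test_function_bounded (R : realType) (N : nat) (Omega : set 'rV[R]_N)
    (f : 'rV[R]_N -> R) : test_function Omega f ->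
  exists2 M, 0 <= M & forall x, `|f x| <= M /\ euclidean_norm (gradient f x) <= M.
Proof.
move=> [sf cf _].
have [M1 M10 hM1] := continuous_compactly_bounded cf (smooth_continuous sf)
  (@eq0_outside_support _ _ f).
have [M2 M20 hM2] := continuous_compactly_bounded cf
  (continuous_euclidean_gradient sf)
  (fun x nc => etrans (congr1 (@euclidean_norm R N) (gradient_eq0_outside_support nc))
    (euclidean_norm0 R N)).
exists (M1 + M2) => [|x]; first exact: addr_ge0.
split; first by rewrite (le_trans (hM1 x))// lerDl.
by rewrite (le_trans (ler_norm _))// (le_trans (hM2 x))// lerDr.
Qed.

(* [x <= L] or [x <= L `^ (1 - p) * x `^ p]: a substitute for Jensen's
   inequality that loses a factor 2. *)
Lemma integral_le_of_powR d (T : measurableType d) (R : realType)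
    (mu : {measure set T -> \bar R}) (Q : set T) (a : T -> R) (p L : R) :
  measurable Q -> (mu Q <= 1)%E -> measurable_fun Q a ->
  (forall x, 0 <= a x) -> 1 <= p -> 0 < L ->
  (\int[mu]_(x in Q) (a x `^ p)%:E <= (L `^ p)%:E)%E ->
  (\int[mu]_(x in Q) (a x)%:E <= (2 * L)%:E)%E.
Proof.
move=> mQ Q1 ma a0 p1 L0 aL.
have mp : measurable_fun Q (fun x => (a x `^ p)%:E).
  by apply/measurable_EFinP; exact: measurableT_comp (measurable_powR _) ma.
apply: (@le_trans _ _ (\int[mu]_(x in Q) (L%:E + (L `^ (1 - p))%:E * (a x `^ p)%:E))%E).
  apply: ge0_le_integral => //.
  - by move=> x _; rewrite lee_fin.
  - exact/measurable_EFinP.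
  - by apply: emeasurable_funD => //; exact: measurable_funeM.
  - move=> x _; rewrite -EFinM -EFinD lee_fin.
    have [aL'|La] := leP (a x) L.
      by rewrite ler_wpDr// mulr_ge0// powR_ge0.
    have ax0 : 0 < a x by exact: lt_trans La.
    (* Here a = a^(1-p) a^p, and a^(1-p) <= L^(1-p) because a > L and 1 - p <= 0. *)
    rewrite ler_wpDl//; first exact: ltW.
    rewrite -[leLHS]powRr1//.
    rewrite -[X in a x `^ X <= _](subrK p) powRD; last by rewrite (gt_eqF ax0) implybT.
    rewrite ler_wpM2r ?powR_ge0//.
    rewrite -[1 - p]opprB !powRN lef_pV2 ?posrE ?powR_gt0//.
    by apply: ge0_ler_powR; rewrite ?nnegrE ?subr_ge0// ltW.
rewrite ge0_integralD//; last 3 first.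
- by move=> x _; rewrite lee_fin ltW.
- by move=> x _; rewrite -EFinM lee_fin mulr_ge0// powR_ge0.
- exact: measurable_funeM.
rewrite integral_cst// ge0_integralZl_EFin//; last 2 first.
- by move=> x _; rewrite lee_fin powR_ge0.
- exact: powR_ge0.
(* Each term contributes one L: the constant because Q has measure at most 1, the other because
   L^(1-p) L^p = L. *)
rewrite mulr_natl mulr2n EFinD leeD//.
  by rewrite -[leRHS]mule1 lee_pmul2l// lte_fin.
apply: (@le_trans _ _ ((L `^ (1 - p))%:E * (L `^ p)%:E)%E).
  by rewrite lee_pmul2l// lte_fin powR_gt0.
rewrite -EFinM -powRD ?subrK ?powRr1//; first exact: ltW.
by rewrite (gt_eqF L0) implybT.
Qed.

(** * The sup bound for test functions *)

Lemma ler_coord_norm (R : realType) (n : nat) (v : 'rV[R]_n) (i : 'I_n) :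
  `|v ord0 i| <= `|v|.
Proof.
by rewrite [leRHS]mx_normrE (le_trans _ (le_bigmax _ _ (ord0, i))).
Qed.

Lemma measurable_path (R : realType) (n : nat) (g : 'rV[R]_n -> R) x (t : R) :
  continuous g -> measurable_fun setT (fun y : 'rV[R]_n => g (x + t *: (y - x))).
Proof.
move=> cg; have -> : (fun y : 'rV[R]_n => g (x + t *: (y - x))) =
    g \o (fun y : 'rV[R]_n => (x - t *: x) + t *: y).
  by apply/funext => y /=; rewrite scalerBr addrAC -addrA.
apply: measurableT_comp; first exact: continuous_measurable_rV.
by apply: continuous_measurable_rV_rV; exact: continuous_affine.
Qed.

(** By the affine change of variables, the p-th power of y -> g (x + t (y - x)) has integral t^(-n)
    times that of g^p, hence at most (L t^(-n/p))^p. Going down from exponent p to 1 on [Q] costs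
    the factor 2. *)
Lemma integral_path_le (R : realType) (n : nat) (Q : set 'rV[R]_n)
    (g : 'rV[R]_n -> R) (p t L : R) x :
  measurable Q -> (lebesgue_rV R n Q <= 1)%E -> continuous g ->
  (forall y, 0 <= g y) -> 1 <= p -> 0 < t -> 0 < L ->
  (\int[lebesgue_rV R n]_y (g y `^ p)%:E <= (L `^ p)%:E)%E ->
  (\int[lebesgue_rV R n]_(y in Q) (g (x + t *: (y - x)))%:E <=
    (2 * (L * t `^ (- (n%:R / p))))%:E)%E.
Proof.
move=> mQ Q1 cg g0 p1 t0 L0 gL.
have p0 : 0 < p by exact: lt_le_trans p1.
apply: (@integral_le_of_powR _ _ _ _ _ _ p) => //.
- exact: measurable_funTS (measurable_path _ _ cg).
- by rewrite mulr_gt0// powR_gt0.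
have mgp : measurable_fun setT (fun y => (g y `^ p)%:E).
  apply/measurable_EFinP; apply: measurableT_comp (measurable_powR _) _.
  exact: continuous_measurable_rV.
have mgpt : measurable_fun setT (fun y : 'rV[R]_n => (g (x + t *: (y - x)) `^ p)%:E).
  apply/measurable_EFinP; apply: measurableT_comp (measurable_powR _) _.
  exact: measurable_path.
apply: (@le_trans _ _ (\int[lebesgue_rV R n]_y (g (x + t *: (y - x)) `^ p)%:E)%E).
  by apply: ge0_subset_integral => // y _; rewrite lee_fin powR_ge0.
under eq_integral => y _.
  have -> : x + t *: (y - x) = (x - t *: x) + t *: y.
    by rewrite scalerBr addrAC -addrA.
  over.
rewrite (@ge0_integral_affine _ _ _ _ (fun z => (g z `^ p)%:E))//; last first.
  by move=> y; rewrite lee_fin powR_ge0.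
rewrite powRM ?powR_ge0//; last exact: ltW.
rewrite -powRrM mulNr divfK ?gt_eqF// powRN powR_mulrn ?(ltW t0)//.
rewrite [X in (_ <= X%:E)%E]mulrC EFinM lee_pmul2l// lte_fin.
by rewrite invr_gt0 exprn_gt0.
Qed.

Lemma normr_Rintegral_le d (T : measurableType d) (R : realType)
    (mu : {measure set T -> \bar R}) (Q : set T) (g : T -> R) (r : R) :
  measurable Q -> mu.-integrable Q (EFin \o g) ->
  (\int[mu]_(y in Q) `|g y|%:E <= r%:E)%E -> `|\int[mu]_(y in Q) g y| <= r.
Proof.
move=> mQ ig gr; apply: le_trans (le_normr_Rintegral mQ ig) _.
have := integrable_fin_num mQ (integrable_norm ig).
rewrite /Rintegral -lee_fin => fn; rewrite fineK//.
Qed.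

Lemma integrable_of_norm_le d (T : measurableType d) (R : realType)
    (mu : {measure set T -> \bar R}) (Q : set T) (g : T -> R) (M : R) :
  measurable Q -> (mu Q < +oo)%E -> measurable_fun Q g ->
  (forall y, Q y -> `|g y| <= M) -> mu.-integrable Q (EFin \o g).
Proof.
move=> mQ Qoo mg gM; apply: measurable_bounded_integrable => //.
by exists M; split; rewrite ?num_real// => r Mr y Qy /=; rewrite (le_trans (gM y Qy))// ltW.
Qed.

(** [C] does not depend on [f], so the bound survives approximation by test functions. [L] is any
    positive bound of the L^p norm of the gradient, so that no division by a possibly zero norm
    occurs. *)
Lemma test_function_sup_bound (R : realType) (N : nat) (Omega : set 'rV[R]_N)
    (p : R) : (0 < N)%N -> bounded_set Omega -> N%:R < p ->
  exists2 C, 0 <= C & forall f (L : R), test_function Omega f -> 0 < L ->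
    (\int[lebesgue_rV R N]_x (euclidean_norm (gradient f x) `^ p)%:E <=
      (L `^ p)%:E)%E -> forall x, `|f x| <= C * L.
Proof.
move=> N0 [K0 [_ hK]] Np.
have p1 : 1 <= p by rewrite (le_trans _ (ltW Np))// ler1n.
have p0 : 0 < p by exact: lt_le_trans p1.
pose K : R := `|K0| + 1.
have OK x i : Omega x -> `|x ord0 i| <= K.
  move=> Ox; rewrite (le_trans (ler_coord_norm _ _))// hK//.
  by rewrite (le_lt_trans (ler_norm _))// ltrDl.
(* A unit cube whose points have all coordinates above [K], while those of [Omega] have theirs at
   most [K]; comparing the coordinate of index 0 shows disjointness. *)
pose Q := box N (K + 1) (K + 2).
have mQ : measurable Q := measurable_box (K + 1) (K + 2).
have Q1 : lebesgue_rV R N Q = 1%E.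
  rewrite lebesgue_rV_box ?lerD2l ?ler1n// (_ : _ - _ = 1) ?expr1n//; ring.
have Qoo : (lebesgue_rV R N Q < +oo)%E by rewrite Q1 ltry.
have QO y : Q y -> ~ Omega y.
  move=> Qy Oy; have := Qy (Ordinal N0); have := OK _ (Ordinal N0) Oy.
  by rewrite in_itv/= ler_norml => /andP[_ h1] /andP[h2 _]; lra.
(* Chosen so that (m+1) (1 - N/p) > 1, which says that the exponent m - (m+1) N/p is positive. *)
pose m := Num.trunc (1 - N%:R / p)^-1.
have pm : 0 <= m%:R - m.+1%:R * (N%:R / p).
  have c0 : 0 < 1 - N%:R / p by rewrite subr_gt0 ltr_pdivrMr// mul1r.
  have := truncnS_gt (1 - N%:R / p)^-1; rewrite -/m.
  rewrite -(@ltr_pM2r _ (1 - N%:R / p))// mulVf ?gt_eqF// -natr1; nra.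
(* m + 1 comes from the speed of the path, 2K + 2 bounds each |y_i - x_i| for x in [Omega] and y in
   [Q], and N counts the coordinates. *)
pose D : R := m.+1%:R * ((2 * K + 2) * N%:R).
have KD : 0 <= K by rewrite addr_ge0.
have D0 : 0 <= D by rewrite !mulr_ge0// addr_ge0// mulr_ge0.
have DL0 : 0 <= D * 2 by exact: mulr_ge0.
exists (D * 2) => [//|f L tf L0 fL x].
have [Ox|nOx] := pselect (Omega x); last first.
  have [-> _] := test_function_outside tf nOx.
  by rewrite normr0; exact: mulr_ge0 DL0 (ltW L0).
have [sf _ _] := tf.
have [M M0 fM] := test_function_bounded tf.
pose E : 'rV[R]_N -> R := euclidean_norm \o gradient f.
have cE : continuous E by exact: continuous_euclidean_gradient.
pose h (s : R) (y : 'rV[R]_N) := f (x + s ^+ m.+1 *: (y - x)).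
pose dh (s : R) (y : 'rV[R]_N) := m.+1%:R * s ^+ m * \sum_i (y - x) ord0 i *
  partial i f (x + s ^+ m.+1 *: (y - x)).
have hdh (s : R) (y : 'rV[R]_N) : is_derive s 1 (h ^~ y) (dh s y).
  by apply: is_derive_power_path => z; exact: smooth_differentiable.
have hdhE (s : R) (y : 'rV[R]_N) : partial1of2 h s y = dh s y.
  by rewrite partial1of2E; exact: derive_val.
have dhE (s : R) (y : 'rV[R]_N) : Q y ->
    `|dh s y| <= D * `|s| ^+ m * E (x + s ^+ m.+1 *: (y - x)).
  move=> Qy; rewrite /dh !normrM normrX ger0_norm// /D.
  set Ey := E _; have -> : m.+1%:R * ((2 * K + 2) * N%:R) * `|s| ^+ m * Ey =
      m.+1%:R * `|s| ^+ m * ((2 * K + 2) * Ey * N%:R) by ring.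
  rewrite ler_wpM2l//.
  apply: (le_trans (ler_norm_sum _ _ _)).
  apply: (@le_trans _ _ (\sum_(i < N) (2 * K + 2) * Ey)).
    apply: ler_sum => i _; rewrite normrM ler_pM//.
      have := OK _ i Ox; rewrite ler_norml => /andP[? ?].
      have := Qy i; rewrite in_itv/= => /andP[? ?].
      by rewrite !mxE ler_norml; apply/andP; split; lra.
    have := ler_coord_euclidean_norm (gradient f (x + s ^+ m.+1 *: (y - x))) i.
    by rewrite mxE.
  by rewrite sumr_const card_ord [leRHS]mulr_natr.
have ih (s : R) : (lebesgue_rV R N).-integrable Q (EFin \o h s).
  apply: (@integrable_of_norm_le _ _ _ _ _ _ M) => //.
    apply: measurable_funTS; apply: measurable_path.
    exact: smooth_continuous.
  by move=> y _; exact: (fM _).1.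
(* Dominating function for s in ]-1, 2[, where |s|^m <= 2^m. This open interval contains [0, 1], so
   [F] is differentiable at the end points as well. *)
pose G : 'rV[R]_N -> R := cst (D * 2 ^+ m * M).
have G0 (y : 'rV[R]_N) : 0 <= G y by exact: mulr_ge0 (mulr_ge0 D0 (exprn_ge0 m _)) M0.
have dhG (s : R) (y : 'rV[R]_N) : `]-1, 2[%classic s -> Q y -> `|dh s y| <= G y.
  rewrite /= in_itv/= => /andP[s1 s2] Qy; apply: le_trans (dhE s y Qy) _.
  rewrite /G /= ler_pM//.
  - exact: mulr_ge0 D0 (exprn_ge0 m _).
  - exact: euclidean_norm_ge0.
  - by rewrite ler_wpM2l// lerXn2r// ?nnegrE// ler_norml; lra.
  - exact: (fM _).2.
have iG : (lebesgue_rV R N).-integrable Q (EFin \o G).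
  apply: (@integrable_of_norm_le _ _ _ _ _ _ (D * 2 ^+ m * M)) => // [|y _].
    exact: measurable_cst.
  by rewrite ger0_norm.
pose F (s : R) : R := \int[lebesgue_rV R N]_(y in Q) h s y.
have dhGp (s : R) (y : 'rV[R]_N) : `]-1, 2[%classic s -> Q y -> `|partial1of2 h s y| <= G y.
  by move=> ? ?; rewrite hdhE; exact: dhG.
have dF (s : R) : `]-1, 2[%classic s ->
    is_derive s 1 F (\int[lebesgue_rV R N]_(y in Q) dh s y).
  move=> Is; apply: DeriveDef.
    exact: (derivable_under_integral mQ Is (fun _ _ => ih _)
      (fun _ _ _ _ => @ex_derive _ _ _ _ _ _ _ (hdh _ _)) G0 iG dhGp).
  rewrite -derive1E (differentiation_under_integral mQ Is (fun _ _ => ih _)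
      (fun _ _ _ _ => @ex_derive _ _ _ _ _ _ _ (hdh _ _)) G0 iG dhGp).
  by apply: eq_Rintegral => y _; exact: hdhE.
have I01 (s : R) : 0 <= s -> s <= 1 -> `]-1, 2[%classic s.
  by move=> ? ?; rewrite /= in_itv/=; lra.
pose dF1 (s : R) : R := \int[lebesgue_rV R N]_(y in Q) dh s y.
have F01 (s : R) : s \in `]0, 1[ -> is_derive s 1 F (dF1 s).
  by rewrite in_itv/= => /andP[s0 s1]; apply/dF/I01; exact: ltW.
have cF : {within `[0, 1], continuous F}.
  apply: derivable_within_continuous => s; rewrite in_itv/= => /andP[s0 s1].
  by have [] := dF s (I01 s s0 s1).
(* At s = 1 the path ends at y in [Q], where [f] vanishes; at s = 0 the integrand is the constant
   f(x) and [Q] has measure 1. Hence |f(x)| = |F'(c)| for some 0 < c < 1. *)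
have [c] := MVT (@ltr01 R) F01 cF.
rewrite in_itv/= subr0 mulr1 => /andP[c0 c1].
have -> : F 1 = 0.
  rewrite /F /h; under eq_Rintegral => y /set_mem Qy.
    rewrite expr1n scale1r addrC subrK (test_function_outside tf (QO y Qy)).1.
    over.
  by rewrite Rintegral_cst// mul0r.
have -> : F 0 = f x.
  rewrite /F /h; under eq_Rintegral => y _.
    rewrite expr0n /= scale0r addr0.
    over.
  by rewrite Rintegral_cst// Q1 mulr1.
have mdh : measurable_fun Q (dh c).
  apply: measurable_funTS; apply: measurable_funM => //.
  apply: measurable_sum => i; apply: measurable_funM; last first.
    apply: measurable_path; apply: smooth_continuous.
    exact: smooth_partial.
  have -> : (fun y => (y - x) ord0 i) = (fun y : 'rV[R]_N => y ord0 i - x ord0 i).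
    by apply/funext => y; rewrite !mxE.
  by apply: measurable_funB => //; exact: measurable_coord_rV.
rewrite sub0r => Efx; rewrite -normrN Efx; apply: normr_Rintegral_le => //.
  apply: (@integrable_of_norm_le _ _ _ _ _ _ (D * 2 ^+ m * M)) => //.
  by move=> y; apply: dhG; apply: I01; exact: ltW.
have mEp : measurable_fun setT (fun y : 'rV[R]_N => (E (x + c ^+ m.+1 *: (y - x)))%:E).
  by apply/measurable_EFinP; exact: measurable_path.
apply: (@le_trans _ _ (\int[lebesgue_rV R N]_(y in Q)
    ((D * c ^+ m)%:E * (E (x + c ^+ m.+1 *: (y - x)))%:E))%E).
  apply: ge0_le_integral => //.
  - exact/measurable_EFinP/measurableT_comp.
  - apply: measurable_funTS; exact: measurable_funeM.
  - move=> y Qy; rewrite -EFinM lee_fin; apply: le_trans (dhE c y Qy) _.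
    by rewrite (ger0_norm (ltW c0)).
rewrite ge0_integralZl_EFin//; last 3 first.
- by move=> y _; rewrite lee_fin; exact: euclidean_norm_ge0.
- exact: measurable_funTS.
- exact: mulr_ge0 D0 (exprn_ge0 m (ltW c0)).
(* The contraction factor is t = c^(m+1). *)
have := integral_path_le x mQ _ cE (fun _ => euclidean_norm_ge0 _) p1
  (exprn_gt0 m.+1 c0) L0 fL.
rewrite Q1 => /(_ (lexx _)) IE.
have Dc0 : (0 <= (D * c ^+ m)%:E)%E.
  by rewrite lee_fin; exact: mulr_ge0 D0 (exprn_ge0 m (ltW c0)).
apply: le_trans (lee_wpmul2l Dc0 IE) _.
rewrite -EFinM lee_fin.
have -> : D * c ^+ m * (2 * (L * (c ^+ m.+1) `^ (- (N%:R / p)))) =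
    D * 2 * L * (c ^+ m * (c ^+ m.+1) `^ (- (N%:R / p))) by ring.
rewrite -[leRHS]mulr1; apply: ler_wpM2l; first exact: mulr_ge0 DL0 (ltW L0).
(* What remains is c^(m - (m+1) N/p) <= 1, true because 0 < c < 1 and the exponent is nonnegative by
   [pm]. *)
rewrite -!powR_mulrn ?(ltW c0)// -powRrM -powRD; last first.
  by rewrite (gt_eqF c0) implybT.
by rewrite mulrN -[leRHS](powRr0 c) ger_powR// c0 ltW.
Qed.

(** * Norms *)

Lemma open_measurable_rV (R : realType) (n : nat) (A : set 'rV[R]_n) :
  open A -> measurable A.
Proof. exact: sub_sigma_algebra. Qed.

(** Serves to scale the identity in [weak_gradient], whose integrands have no fixed sign. A factor c
    > 0 scales the positive and negative parts separately; infinite parts are treated case by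
    case. *)
Lemma integralZl_gt0 d (T : measurableType d) (R : realType)
    (mu : {measure set T -> \bar R}) (D : set T) (f : T -> R) (c : R) :
  measurable D -> measurable_fun D f -> 0 < c ->
  (\int[mu]_(x in D) (c * f x)%:E = c%:E * \int[mu]_(x in D) (f x)%:E)%E.
Proof.
move=> mD mf c0; have mf' : measurable_fun D (EFin \o f) by exact/measurable_EFinP.
have -> : (fun x => (c * f x)%:E) = (fun x => c%:E * (EFin \o f) x)%E.
  by apply/funext => x; rewrite EFinM.
rewrite [LHS]integralE [in RHS]integralE.
rewrite (@ge0_funeposM _ _ c (EFin \o f) (ltW c0)).
rewrite (@ge0_funenegM _ _ c (EFin \o f) (ltW c0)).
rewrite !ge0_integralZl_EFin ?(ltW c0)//; last 2 first.
- exact: measurable_funeneg.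
- exact: measurable_funepos.
have := @integral_ge0 _ _ _ mu D ((EFin \o f)^\+)%E (fun x _ => funepos_ge0 _ _).
have := @integral_ge0 _ _ _ mu D ((EFin \o f)^\-)%E (fun x _ => funeneg_ge0 _ _).
case: (integral mu D _) => [b| |] // b0; case: (integral mu D _) => [a| |] // a0.
- by rewrite -!(EFinB, EFinM) mulrBr.
- by rewrite gt0_muley ?lte_fin.
- by rewrite /= gt0_muley ?lte_fin//= gt0_muleNy ?lte_fin.
- by rewrite /= gt0_muley ?lte_fin//= gt0_muleNy ?lte_fin.
Qed.

Lemma bounded_lebesgue_rV_lty (R : realType) (n : nat) (A : set 'rV[R]_n) :
  bounded_set A -> measurable A -> (lebesgue_rV R n A < +oo)%E.
Proof.
move=> [K0 [_ hK]] mA; pose K : R := `|K0| + 1.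
apply: (@le_lt_trans _ _ (lebesgue_rV R n (box n (- K) K))).
  apply: le_measure; rewrite ?inE//; first exact: measurable_box.
  move=> v Av i; rewrite in_itv /= -ler_norml.
  rewrite (le_trans (ler_coord_norm _ _))// hK//.
  by rewrite (le_lt_trans (ler_norm _))// ltrDl.
by rewrite lebesgue_rV_box ?ltry// lerNl (@le_trans _ _ 0)// ?oppr_le0// addr_ge0.
Qed.

Section Lp_norm.
Context {R : realType} {N : nat} (Omega : set 'rV[R]_N).
Implicit Types u : 'rV[R]_N -> R.
Local Notation mu := (lebesgue_rV R N).

Lemma Lp_norm_ge0 s u : (0 <= Lp_norm Omega s u)%E.
Proof. exact: Lnorm_ge0. Qed.

(** The extension by 0 adds nothing outside [Omega], since 0^q = 0 for q > 0. *)
Lemma poweR_Lp_norm q u : 0 < q ->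
  (Lp_norm Omega q%:E u `^ q = \int[mu]_(x in Omega) (`|u x| `^ q)%:E)%E.
Proof.
move=> q0; rewrite /Lp_norm poweR_Lnorm ?gt_eqF// [RHS]integral_mkcond.
apply: eq_integral => x _ /=; rewrite !patchE; case: ifPn => // _.
by rewrite normr0 powR0// gt_eqF.
Qed.

Lemma Lp_normE q u : 0 < q ->
  (Lp_norm Omega q%:E u = (\int[mu]_(x in Omega) (`|u x| `^ q)%:E) `^ q^-1)%E.
Proof.
move=> q0; rewrite -poweR_Lp_norm// -poweRrM divff ?gt_eqF// poweRe1//.
exact: Lp_norm_ge0.
Qed.

(** The norm of exponent [+oo] unfolds to an essential supremum only when the whole space has
    positive measure. *)
Lemma lebesgue_rVT_gt0 : (0 < mu [set: 'rV[R]_N])%E.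
Proof.
apply: (@lt_le_trans _ _ (mu (box N 0 1))).
  by rewrite lebesgue_rV_box// subr0 expr1n lte_fin.
by apply: le_measure; rewrite ?inE//; exact: measurable_box.
Qed.

Lemma Lp_norm_infty_leP u (r : R) : 0 <= r ->
  (Lp_norm Omega +oo%E u <= r%:E)%E <->
  \forall x \ae mu, Omega x -> `|u x| <= r.
Proof.
move=> r0; rewrite /Lp_norm unlock /= lebesgue_rVT_gt0.
split=> [/ess_supP|H].
  apply: filterS => x /= + Ox; rewrite patchE mem_set//.
apply/ess_supP; apply: filterS H => x /= H; rewrite patchE.
(* Off [Omega] the extended function is 0, and 0 <= r. *)
case: ifPn => [/set_mem/H//|_]; by rewrite normr0 lee_fin.
Qed.

Lemma Lp_normZ s u (c : R) : (0 < s)%E -> measurable Omega ->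
  measurable_fun Omega u -> 0 < c ->
  (Lp_norm Omega s (fun x => c * u x)%R = c%:E * Lp_norm Omega s u)%E.
Proof.
move=> + mO mu_ c0; case: s => [q q0| _|//]; last first.
  rewrite /Lp_norm unlock /= lebesgue_rVT_gt0 -ess_sup_pZl//.
  congr ess_sup; apply/funext => x /=; rewrite !patchE; case: ifPn => _.
    by rewrite normrM gtr0_norm// EFinM.
  by rewrite normr0 mule0.
rewrite lte_fin in q0; rewrite !Lp_normE//.
under eq_integral do rewrite normrM (gtr0_norm c0) powRM ?(ltW c0)// EFinM.
rewrite ge0_integralZl_EFin//; last 2 first.
- apply/measurable_EFinP; apply: measurableT_comp (measurable_powR _) _.
  exact: measurableT_comp.
- exact: powR_ge0.
rewrite poweRM ?lee_fin ?powR_ge0//; last first.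
  by apply: integral_ge0 => x _; rewrite lee_fin powR_ge0.
by rewrite poweR_EFin -powRrM divff ?gt_eqF// powRr1// ltW.
Qed.

End Lp_norm.

(** * The space W_0^{1,p} *)

Lemma euclidean_normZ (R : realType) (N : nat) (c : R) (v : 'rV[R]_N) :
  0 <= c -> euclidean_norm (c *: v) = c * euclidean_norm v.
Proof.
move=> c0; rewrite /euclidean_norm.
under eq_bigr do rewrite mxE exprMn.
by rewrite -mulr_sumr sqrtrM ?sqr_ge0// sqrtr_sqr ger0_norm.
Qed.

(** A crude triangle inequality: |v| <= 2 (A + B) <= 4 max(A, B), and the p-th power of the maximum
    is at most the sum of the p-th powers. It is applied with w = g and v the gradient of an
    approximating test function. *)
Lemma powR_euclidean_norm_le (R : realType) (N : nat) (p : R) (v w : 'rV[R]_N) :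
  0 <= p -> euclidean_norm v `^ p <=
    4 `^ p * (euclidean_norm w `^ p + euclidean_norm (w - v) `^ p).
Proof.
move=> p0; set A := euclidean_norm w; set B := euclidean_norm (w - v).
have A0 : 0 <= A := euclidean_norm_ge0 w.
have B0 : 0 <= B := euclidean_norm_ge0 (w - v).
have sqrE (z : 'rV[R]_N) : euclidean_norm z ^+ 2 = \sum_i z ord0 i ^+ 2.
  by rewrite sqr_sqrtr// sumr_ge0// => i _; exact: sqr_ge0.
have vAB : euclidean_norm v <= 2 * (A + B).
  rewrite -(@ler_pXn2r _ 2)// ?nnegrE ?mulr_ge0 ?addr_ge0 ?euclidean_norm_ge0//.
  (* Coordinatewise, 2 w^2 + 2 (w - v)^2 - v^2 is the square of 2 w - v. *)
  apply: (@le_trans _ _ (2 * A ^+ 2 + 2 * B ^+ 2)); last by nra.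
  rewrite !sqrE !mulr_sumr -big_split/=; apply: ler_sum => i _.
  rewrite !mxE -subr_ge0.
  have -> : 2 * w ord0 i ^+ 2 + 2 * (w ord0 i - v ord0 i) ^+ 2 - v ord0 i ^+ 2 =
    (2 * w ord0 i - v ord0 i) ^+ 2 by ring.
  exact: sqr_ge0.
have key (X : R) : 0 <= X -> euclidean_norm v <= 4 * X ->
    euclidean_norm v `^ p <= 4 `^ p * X `^ p.
  move=> X0 vX; rewrite -powRM//.
  by apply: ge0_ler_powR; rewrite ?nnegrE ?mulr_ge0 ?euclidean_norm_ge0.
rewrite mulrDr; have [AB|BA] := leP A B.
  have vB : euclidean_norm v <= 4 * B by lra.
  by rewrite (le_trans (key _ B0 vB))// lerDr mulr_ge0// powR_ge0.
have vA : euclidean_norm v <= 4 * A by lra.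
by rewrite (le_trans (key _ A0 vA))// lerDl mulr_ge0// powR_ge0.
Qed.

Lemma measurable_euclidean_norm d (T : measurableType d) (R : realType)
    (N : nat) (D : set T) (g : T -> 'rV[R]_N) :
  (forall i, measurable_fun D (fun x => g x ord0 i)) ->
  measurable_fun D (euclidean_norm \o g).
Proof.
move=> mg; apply: (measurableT_comp
  (continuous_measurable_fun (@sqrt_continuous R))).
by apply: measurable_sum => i; apply: measurable_funX.
Qed.

Lemma partialZ (R : realType) (N : nat) (c : R) (f : 'rV[R]_N -> R) i :
  (forall x, differentiable f x) ->
  partial i (fun x => c * f x) = (fun x => c * partial i f x).
Proof.
move=> df; apply/funext => x; rewrite /partial.
by rewrite -[LHS]/('D_(delta_mx ord0 i) (c *: f) x) deriveZ//; exact: diff_derivable.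
Qed.

Lemma foldr_partialZ (R : realType) (N : nat) (c : R) (f : 'rV[R]_N -> R) s :
  smooth f ->
  foldr partial (fun x => c * f x) s = (fun x => c * foldr partial f s x).
Proof.
by move=> sf; elim: s => [//|i s /= ->]; rewrite partialZ//; exact: sf.
Qed.

(** A nonzero factor leaves the support unchanged. *)
Lemma test_functionZ (R : realType) (N : nat) (Omega : set 'rV[R]_N) (c : R)
    (f : 'rV[R]_N -> R) : c != 0 ->
  test_function Omega f -> test_function Omega (fun x => c * f x).
Proof.
move=> c0 [sf cf fO].
have -> : test_function Omega (fun x => c * f x) = [/\ smooth (fun x => c * f x),
   compact (closure [set x | f x != 0]) & closure [set x | f x != 0] `<=` Omega].
  rewrite /test_function (_ : [set x | c * f x != 0] = [set x | f x != 0])//.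
  by apply/seteqP; split => x /=; rewrite mulf_eq0 (negbTE c0).
split => // s x; rewrite foldr_partialZ//.
exact: (differentiableZ c (sf s x)).
Qed.

Lemma gradientZ (R : realType) (N : nat) (c : R) (f : 'rV[R]_N -> R) :
  smooth f -> gradient (fun x => c * f x) = (fun x => c *: gradient f x).
Proof.
move=> sf; apply/funext => x; apply/rowP => i; rewrite !mxE partialZ// => y.
exact: smooth_differentiable.
Qed.

Section sobolev0_theory.
Context {R : realType} {N : nat} (Omega : set 'rV[R]_N) (p : R).
Hypothesis (oO : open Omega) (p0 : 0 < p).
Implicit Types (u : 'rV[R]_N -> R) (g : 'rV[R]_N -> 'rV[R]_N).
Local Notation mu := (lebesgue_rV R N).

Let mO : measurable Omega. Proof. exact: open_measurable_rV. Qed.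

Lemma energyE g : energy p Omega g =
  (\int[mu]_(x in Omega) (euclidean_norm (g x) `^ p)%:E)%E.
Proof.
rewrite /energy poweR_Lp_norm//; apply: eq_integral => x _ /=.
by rewrite ger0_norm// euclidean_norm_ge0.
Qed.

Lemma energy_ge0 g : (0 <= energy p Omega g)%E.
Proof. exact: poweR_ge0. Qed.

Lemma energyZ g (c : R) : (forall i, measurable_fun Omega (fun x => g x ord0 i)) ->
  0 < c -> energy p Omega (fun x => c *: g x) = ((c `^ p)%:E * energy p Omega g)%E.
Proof.
move=> mg c0; rewrite /energy.
have -> : euclidean_norm \o (fun x => c *: g x) =
    (fun x => c * (euclidean_norm \o g) x).
  by apply/funext => x /=; rewrite euclidean_normZ// ltW.
rewrite Lp_normZ ?lte_fin//; last exact: measurable_euclidean_norm.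
by rewrite poweRM ?lee_fin ?(ltW c0)// Lp_norm_ge0.
Qed.

Lemma sobolev0Z u g (c : R) : 0 < c -> sobolev0 p Omega u g ->
  sobolev0 p Omega (fun x => c * u x) (fun x => c *: g x).
Proof.
move=> c0 [[[mu_ uoo] Lg wg] appr].
have mg i := (Lg i).1.
have mphi phi : test_function Omega phi -> measurable_fun Omega phi.
  move=> [sphi _ _]; apply: measurable_funTS.
  by apply: continuous_measurable_rV; exact: smooth_continuous.
have mdphi phi i : test_function Omega phi -> measurable_fun Omega (partial i phi).
  move=> [sphi _ _]; apply: measurable_funTS; apply: continuous_measurable_rV.
  by apply: smooth_continuous; exact: smooth_partial.
split; first split.
- split; first exact: measurable_funM.
  by rewrite Lp_normZ ?lte_fin// lte_mul_pinfty// lee_fin ltW.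
- move=> i; have -> : (fun x => (c *: g x) ord0 i) = (fun x => c * g x ord0 i).
    by apply/funext => x; rewrite mxE.
  split; first exact: measurable_funM.
  by rewrite Lp_normZ ?lte_fin// lte_mul_pinfty// ?lee_fin ?(ltW c0)// (Lg i).2.
- move=> phi tphi i.
  under eq_integral do rewrite -mulrA.
  under [in RHS]eq_integral do rewrite mxE -mulrA.
  rewrite integralZl_gt0//; last by apply: measurable_funM => //; exact: mdphi.
  rewrite integralZl_gt0//; last by apply: measurable_funM => //; exact: mphi.
  by rewrite (wg phi tphi i) muleN.
(* The Sobolev norm is homogeneous, so c times an approximation within e/c is one within e. *)
move=> e e0; have [phi tphi uphi] := appr (e / c) (divr_gt0 e0 c0).
exists (fun x => c * phi x); first by apply: test_functionZ; rewrite ?gt_eqF.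
have [sphi _ _] := tphi.
rewrite /sobolev_norm gradientZ//.
have -> : ((fun x => (c * u x)%R) \- (fun x => c * phi x))%R =
    (fun x => c * (u \- phi)%R x) by apply/funext => x /=; rewrite mulrBr.
have -> : euclidean_norm \o ((fun x => c *: g x) \- (fun x => c *: gradient phi x))%R
    = (fun x => c * (euclidean_norm \o (g \- gradient phi)%R) x).
  by apply/funext => x /=; rewrite -scalerBr euclidean_normZ// ltW.
rewrite !Lp_normZ ?lte_fin//; last 2 first.
- apply: measurable_euclidean_norm => i.
  have -> : (fun x => (g \- gradient phi)%R x ord0 i) =
      (fun x => g x ord0 i - partial i phi x).
    by apply/funext => x; rewrite !mxE.
  by apply: measurable_funB => //; exact: mdphi.
- by apply: measurable_funB => //; exact: mphi.
rewrite -ge0_muleDr ?Lp_norm_ge0//.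
by rewrite -lte_pdivlMl// -EFinM mulrC.
Qed.

End sobolev0_theory.

(** Test functions close to [u] share one sup bound C L. Where |u| > C L + 1 they differ from [u] by
    more than 1, so by Chebyshev's inequality this set has arbitrarily small measure. *)
Lemma sobolev0_essentially_bounded (R : realType) (N : nat)
    (Omega : set 'rV[R]_N) (p : R) (u : 'rV[R]_N -> R)
    (g : 'rV[R]_N -> 'rV[R]_N) :
  (0 < N)%N -> open Omega -> bounded_set Omega -> N%:R < p ->
  sobolev0 p Omega u g -> (energy p Omega g < +oo)%E ->
  exists2 K, 0 <= K & (Lp_norm Omega +oo%E u <= K%:E)%E.
Proof.
move=> N0 oO bO Np [[[mu_ _] Lg _] appr] Eoo.
have mO := open_measurable_rV oO.
have p1 : 1 <= p by rewrite (le_trans _ (ltW Np))// ler1n.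
have p0 : 0 < p by exact: lt_le_trans p1.
have [C C0 hC] := test_function_sup_bound N0 bO Np.
pose A := fine (energy p Omega g).
have EA : energy p Omega g = A%:E.
  by rewrite fineK// ge0_fin_numE// energy_ge0.
have A0 : 0 <= A by rewrite -lee_fin -EA energy_ge0.
(* L^p = 4^p (A + 1), where A is the energy of [g] and 1 bounds the p-th power of the approximation
   error of the gradient. *)
pose L := 4 * (A + 1) `^ p^-1.
have L0 : 0 < L by rewrite mulr_gt0// powR_gt0// ltr_wpDl.
have Lp : L `^ p = 4 `^ p * (A + 1).
  rewrite powRM ?powR_ge0// -powRrM mulVf ?gt_eqF// powRr1//.
  by rewrite addr_ge0.
have mpowR (f : 'rV[R]_N -> R) D : measurable_fun D f ->
    measurable_fun D (fun x => (f x `^ p)%:E).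
  by move=> mf; apply/measurable_EFinP; exact: measurableT_comp (measurable_powR _) mf.
have approx e : 0 < e -> e <= 1 -> exists phi : 'rV[R]_N -> R,
    [/\ measurable_fun Omega phi, forall x, `|phi x| <= C * L &
      (\int[lebesgue_rV R N]_(x in Omega) (`|u x - phi x| `^ p)%:E <= e%:E)%E].
  move=> e0 e1; have [phi tphi near_phi] := appr e e0.
  have [sphi _ _] := tphi.
  (* For z < e <= 1 and p >= 1, raising to the power p does not increase z. *)
  have le_pow (z : \bar R) : (0 <= z -> z < e%:E -> z `^ p <= e%:E)%E.
    case: z => [r| |]//; rewrite lee_fin lte_fin => r0 re.
    rewrite poweR_EFin lee_fin (le_trans _ (ltW re))//.
    have [->|rn0] := eqVneq r 0; first by rewrite powR0// gt_eqF.
    by rewrite ge1r_powR// lt_def rn0 r0/= (le_trans (ltW re)).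
  have [u_phi g_phi] : (Lp_norm Omega p%:E (u \- phi)%R < e%:E)%E /\
      (Lp_norm Omega p%:E (euclidean_norm \o (g \- gradient phi)%R) < e%:E)%E.
    by split; apply: le_lt_trans near_phi; rewrite /sobolev_norm ?leeDl ?leeDr
      ?Lp_norm_ge0.
  have mphi : measurable_fun Omega phi.
    apply: measurable_funTS; apply: continuous_measurable_rV.
    exact: smooth_continuous.
  have mgphi : measurable_fun setT (euclidean_norm \o gradient phi).
    by apply: continuous_measurable_rV; exact: continuous_euclidean_gradient.
  have meg : measurable_fun Omega (euclidean_norm \o g).
    by apply: measurable_euclidean_norm => i; exact: (Lg i).1.
  have megphi : measurable_fun Omega (euclidean_norm \o (g \- gradient phi)%R).
    apply: measurable_euclidean_norm => i.
    have -> : (fun x => (g \- gradient phi)%R x ord0 i) =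
        (fun x => g x ord0 i - partial i phi x).
      by apply/funext => x; rewrite !mxE.
    apply: measurable_funB; first exact: (Lg i).1.
    apply: measurable_funTS; apply: continuous_measurable_rV.
    by apply: smooth_continuous; exact: smooth_partial.
  exists phi; split => //.
    apply: hC => //.
    have -> : (\int[lebesgue_rV R N]_x (euclidean_norm (gradient phi x) `^ p)%:E =
        \int[lebesgue_rV R N]_(x in Omega) (euclidean_norm (gradient phi x) `^ p)%:E)%E.
      rewrite [RHS]integral_mkcond; apply: eq_integral => x _.
      rewrite patchE; case: ifPn => // /negP nO.
      have [_ ->] := test_function_outside tphi (fun h => nO (mem_set h)).
      by rewrite euclidean_norm0 powR0// gt_eqF.
    apply: (@le_trans _ _ (\int[lebesgue_rV R N]_(x in Omega)
        ((4 `^ p)%:E * ((euclidean_norm (g x) `^ p)%:E +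
           (euclidean_norm ((g \- gradient phi)%R x) `^ p)%:E)))%E).
      apply: ge0_le_integral => //.
      - by move=> x _; rewrite lee_fin powR_ge0.
      - exact: mpowR (measurable_funTS mgphi).
      - by apply: measurable_funeM; apply: emeasurable_funD; exact: mpowR.
      - by move=> x _; rewrite -EFinD -EFinM lee_fin powR_euclidean_norm_le// ltW.
    rewrite ge0_integralZl_EFin//; last 2 first.
    - by move=> x _; rewrite -EFinD lee_fin addr_ge0// powR_ge0.
    - by apply: emeasurable_funD; exact: mpowR.
    rewrite ge0_integralD//; last 4 first.
    - by move=> x _; rewrite lee_fin powR_ge0.
    - exact: mpowR meg.
    - by move=> x _; rewrite lee_fin powR_ge0.
    - exact: mpowR megphi.
    rewrite Lp EFinM EFinD lee_wpmul2l// ?lee_fin ?powR_ge0//.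
    apply: leeD; first by rewrite -energyE// EA.
    have := le_pow _ (Lp_norm_ge0 _ _ _) g_phi.
    rewrite -/(energy p Omega _) energyE// => /le_trans; apply.
    by rewrite lee_fin.
  have := le_pow _ (Lp_norm_ge0 _ _ _) u_phi.
  by rewrite poweR_Lp_norm.
pose K := C * L + 1.
have K0 : 0 <= K by rewrite addr_ge0// mulr_ge0// ltW.
exists K => //; apply/Lp_norm_infty_leP => //.
pose S := Omega `&` (fun x => `|u x|) @^-1` `]K, +oo[.
have mS : measurable S.
  have mabs : measurable_fun Omega (fun x => `|u x|) by exact: measurableT_comp.
  exact: mabs.
have Se e : 0 < e -> e <= 1 -> (lebesgue_rV R N S <= e%:E)%E.
  move=> e0 e1; have [phi [mphi phiCL uphi]] := approx e e0 e1.
  have mup : measurable_fun Omega (fun x => (`|u x - phi x| `^ p)%:E).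
    apply: (mpowR (fun x => `|u x - phi x|)); apply: measurableT_comp => //.
    exact: measurable_funB.
  apply: le_trans uphi.
  apply: (@le_trans _ _ (\int[lebesgue_rV R N]_(x in S) (`|u x - phi x| `^ p)%:E)%E).
    rewrite -[leLHS]mul1e -integral_cst//; apply: ge0_le_integral => //.
    - by apply: measurable_funS mup => //; exact: subIsetl.
    - move=> x [Ox]; rewrite /= in_itv/= andbT => Kx.
      rewrite lee_fin -(powRr0 `|u x - phi x|) ler_powR// ?ltW//.
      have := ler_normD (u x - phi x) (phi x); rewrite subrK.
      by have := phiCL x; rewrite /K in Kx; lra.
  by apply: ge0_subset_integral => //; exact: subIsetl.
exists S; split => //.
  apply/eqP; rewrite eq_le measure_ge0 andbT.
  apply/lee_addgt0Pr => e e0; rewrite add0e.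
  have [e1|e1] := leP e 1; first exact: Se.
  by rewrite (le_trans (Se 1 _ _))// lee_fin ltW.
move=> x /= nx; apply: contrapT => nS; apply: nx => Ox.
rewrite leNgt; apply/negP => Kx; apply: nS; split => //=.
by rewrite in_itv/= Kx.
Qed.

(** * Comparison of the L^q norms with the sup norm *)

Section finite_measure_domain.
Context {R : realType} {N : nat} (Omega : set 'rV[R]_N) (u : 'rV[R]_N -> R).
Hypothesis (mO : measurable Omega) (mu_ : measurable_fun Omega u).
Local Notation mu := (lebesgue_rV R N).

Let mpow q : measurable_fun Omega (fun x => (`|u x| `^ q)%:E).
Proof.
apply/measurable_EFinP; apply: measurableT_comp (measurable_powR _) _.
exact: measurableT_comp.
Qed.

Lemma Lp_norm_le_infty (q r V : R) : 0 < q -> 0 <= r -> 0 <= V ->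
  (mu Omega <= V%:E)%E -> (Lp_norm Omega +oo%E u <= r%:E)%E ->
  (Lp_norm Omega q%:E u <= (r * V `^ q^-1)%:E)%E.
Proof.
move=> q0 r0 V0 OV /(Lp_norm_infty_leP _ _ r0) ur; rewrite Lp_normE//.
apply: (@le_trans _ _ ((r `^ q * V)%:E `^ q^-1)%E); last first.
  rewrite poweR_EFin lee_fin powRM ?powR_ge0// -powRrM divff ?gt_eqF//.
  by rewrite powRr1.
apply: gt0_ler_poweR; rewrite ?invr_ge0 ?(ltW q0)//.
- rewrite in_itv/= leey andbT; apply: integral_ge0 => x _.
  by rewrite lee_fin powR_ge0.
- by rewrite in_itv/= lee_fin mulr_ge0 ?powR_ge0//= leey.
apply: (@le_trans _ _ (\int[mu]_(x in Omega) (r `^ q)%:E)%E).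
  apply: ae_ge0_le_integral => //.
  - by move=> x _; rewrite lee_fin powR_ge0.
  - apply: filterS ur => x /= ur Ox; rewrite lee_fin.
    by apply: ge0_ler_powR; rewrite ?nnegrE ?(ltW q0)//; exact: ur.
by rewrite integral_cst// EFinM lee_wpmul2l// lee_fin powR_ge0.
Qed.

(** [a] is the measure of the set where |u| > d, positive because d lies below the essential
    supremum. It is the same for all q, so that a^(1/q) tends to 1. *)
Lemma Lp_norm_ge_infty (d : R) : 0 <= d -> (mu Omega < +oo)%E ->
  (d%:E < Lp_norm Omega +oo%E u)%E ->
  exists2 a, 0 < a & forall q, 0 < q ->
    ((d * a `^ q^-1)%:E <= Lp_norm Omega q%:E u)%E.
Proof.
move=> d0 Ooo ud.
pose S := Omega `&` (fun x => `|u x|) @^-1` `]d, +oo[.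
have mS : measurable S.
  have mabs : measurable_fun Omega (fun x => `|u x|) by exact: measurableT_comp.
  exact: mabs.
have Soo : (mu S < +oo)%E.
  by apply: le_lt_trans Ooo; apply: le_measure; rewrite ?inE//; exact: subIsetl.
have S0 : (0 < mu S)%E.
  rewrite lt_neqAle measure_ge0 andbT eq_sym; apply/eqP => S0.
  move: ud; rewrite ltNge => /negP; apply; apply/Lp_norm_infty_leP => //.
  exists S; split => // x /= nx; apply: contrapT => nS; apply: nx => Ox.
  rewrite leNgt; apply/negP => Kx; apply: nS; split => //=.
  by rewrite in_itv/= Kx.
have Sfin : mu S \is a fin_num by rewrite ge0_fin_numE.
exists (fine (mu S)) => [|q q0]; first by rewrite -lte_fin fineK.
have a0 : 0 <= fine (mu S) by rewrite fine_ge0.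
rewrite Lp_normE//.
apply: (@le_trans _ _ ((d `^ q * fine (mu S))%:E `^ q^-1)%E).
  rewrite poweR_EFin lee_fin powRM ?powR_ge0// -powRrM divff ?gt_eqF//.
  by rewrite powRr1.
apply: gt0_ler_poweR; rewrite ?invr_ge0 ?(ltW q0)//.
- by rewrite in_itv/= lee_fin mulr_ge0 ?powR_ge0//= leey.
- rewrite in_itv/= leey andbT; apply: integral_ge0 => x _.
  by rewrite lee_fin powR_ge0.
apply: (@le_trans _ _ (\int[mu]_(x in S) (`|u x| `^ q)%:E)%E); last first.
  by apply: ge0_subset_integral => //; exact: subIsetl.
rewrite EFinM fineK// -integral_cst//; apply: ge0_le_integral => //.
- by move=> x _; rewrite lee_fin powR_ge0.
- apply: measurable_funS (mpow q) => //; exact: subIsetl.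
move=> x [Ox]; rewrite /= in_itv/= andbT => dx; rewrite lee_fin.
by apply: ge0_ler_powR; rewrite ?nnegrE ?(ltW q0) ?(ltW dx).
Qed.

End finite_measure_domain.

(** * The limit *)

Section lambda_bounds.
Context {R : realType} {N : nat} (Omega : set 'rV[R]_N) (p : R).
Hypothesis (N0 : (0 < N)%N) (oO : open Omega) (bO : bounded_set Omega).
Hypothesis Np : N%:R < p.
Local Notation mu := (lebesgue_rV R N).

Definition lambda_infty : \bar R :=
  ereal_inf [set E | exists u g, [/\ sobolev0 p Omega u g,
    Lp_norm Omega +oo%E u = 1%E & E = energy p Omega g]].

Let p0 : 0 < p. Proof. by rewrite (le_lt_trans _ Np). Qed.
Let mO : measurable Omega. Proof. exact: open_measurable_rV. Qed.

Lemma lambda_infty_ge0 : (0 <= lambda_infty)%E.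
Proof.
by apply: le_ereal_inf_tmp => _ [u [g [_ _ ->]]]; exact: energy_ge0.
Qed.

(** Homogeneity: [u] and [g] are divided by t. It is used both with s = [+oo] and with s = q. *)
Lemma energy_normalized (u : 'rV[R]_N -> R) (g : 'rV[R]_N -> 'rV[R]_N)
    (s : \bar R) (t : R) :
  (0 < s)%E -> 0 < t -> sobolev0 p Omega u g -> Lp_norm Omega s u = t%:E ->
  exists v h, [/\ sobolev0 p Omega v h, Lp_norm Omega s v = 1%E &
    energy p Omega h = ((t `^ (- p))%:E * energy p Omega g)%E].
Proof.
move=> s0 t0 ug us; have ti0 : 0 < t^-1 by rewrite invr_gt0.
exists (fun x => t^-1 * u x), (fun x => t^-1 *: g x).
have [[[mu_ _] Lg _] _] := ug.
split; first exact: sobolev0Z.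
- by rewrite Lp_normZ// us -EFinM mulVf// gt_eqF.
- rewrite energyZ//; last by move=> i; exact: (Lg i).1.
  by rewrite -powR_inv1 ?(ltW t0)// -powRrM mulN1r.
Qed.

Lemma lambda_ge (V : R) : 0 < V -> (mu Omega <= V%:E)%E -> forall q, 0 < q ->
  (((V `^ (- p)) `^ q^-1)%:E * lambda_infty <= lambda p Omega q)%E.
Proof.
move=> V0 OV q q0; apply: le_ereal_inf_tmp => _ [u [g [ug uq ->]]].
have [Ey|] := eqVneq (energy p Omega g) +oo%E; first by rewrite Ey leey.
rewrite -ltey => Eoo.
have [K K0 uK] := sobolev0_essentially_bounded N0 oO bO Np ug Eoo.
have ufin : Lp_norm Omega +oo%E u \is a fin_num.
  by rewrite ge0_fin_numE ?Lp_norm_ge0// (le_lt_trans uK)// ltry.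
pose t := fine (Lp_norm Omega +oo%E u).
have ut : Lp_norm Omega +oo%E u = t%:E by rewrite fineK.
have t0 : 0 <= t by rewrite -lee_fin -ut Lp_norm_ge0.
have [[[mu_ _] _ _] _] := ug.
(* This is the comparison of norms with ||u||_q = 1; it also excludes t = 0. *)
have tV1 : 1 <= t * V `^ q^-1.
  by rewrite -lee_fin -uq; apply: Lp_norm_le_infty; rewrite ?(ltW V0)// ut.
have {}t0 : 0 < t.
  rewrite lt_neqAle t0 andbT; apply/eqP => t00.
  by move: tV1; rewrite -t00 mul0r ler10.
have [v [h [vh v1 hE]]] := energy_normalized (ltry 0) t0 ug ut.
have : (lambda_infty <= energy p Omega h)%E.
  by apply: ereal_inf_lbound; exists v, h.
rewrite hE => ME.
have VV0 : (0 <= ((V `^ (- p)) `^ q^-1)%:E)%E by rewrite lee_fin powR_ge0.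
apply: le_trans (lee_wpmul2l VV0 ME) _.
rewrite muleA -EFinM -[leRHS]mul1e lee_wpmul2r ?energy_ge0// lee_fin.
(* The two factors combine into (t V^(1/q))^(-p), which is at most 1 by [tV1]. *)
rewrite powRAC -powRM ?powR_ge0// ?(ltW t0)// mulrC.
rewrite powRN invf_le1 ?powR_gt0 ?mulr_gt0 ?powR_gt0//.
have := @ge0_ler_powR R p (ltW p0) 1 (t * V `^ q^-1).
by rewrite powR1 !nnegrE /= => H; apply: H => //; exact: le_trans tV1.
Qed.

Lemma lambda_le (u : 'rV[R]_N -> R) (g : 'rV[R]_N -> 'rV[R]_N) (d : R) :
  0 < d < 1 -> sobolev0 p Omega u g -> Lp_norm Omega +oo%E u = 1%E ->
  exists2 c, 0 < c & forall q, 0 < q ->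
    (lambda p Omega q <= (d `^ (- p) * c `^ q^-1)%:E * energy p Omega g)%E.
Proof.
move=> /andP[d0 d1] ug u1; have [[[mu_ _] _ _] _] := ug.
have Ooo : (mu Omega < +oo)%E by exact: bounded_lebesgue_rV_lty.
have [a a0 ua] : exists2 a, 0 < a & forall q, 0 < q ->
    ((d * a `^ q^-1)%:E <= Lp_norm Omega q%:E u)%E.
  by apply: Lp_norm_ge_infty; rewrite ?(ltW d0)// u1 lte_fin.
(* With c = a^(-p), the bound d^(-p) c^(1/q) equals (d a^(1/q))^(-p). *)
exists (a `^ (- p)) => [|q q0]; first exact: powR_gt0.
have uqoo : (Lp_norm Omega q%:E u < +oo)%E.
  apply: le_lt_trans (ltry _); apply: (@Lp_norm_le_infty _ _ _ _ _ _ _ 1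
    (fine (mu Omega))) => //; rewrite ?u1// ?fine_ge0// fineK// ge0_fin_numE//.
have ufin : Lp_norm Omega q%:E u \is a fin_num.
  by rewrite ge0_fin_numE ?Lp_norm_ge0.
pose t := fine (Lp_norm Omega q%:E u).
have ut : Lp_norm Omega q%:E u = t%:E by rewrite fineK.
have dt : d * a `^ q^-1 <= t by rewrite -lee_fin -ut ua.
have da0 : 0 < d * a `^ q^-1 by rewrite mulr_gt0// powR_gt0.
have t0 : 0 < t by exact: lt_le_trans dt.
have [v [h [vh v1 hE]]] := energy_normalized (s := q%:E) q0 t0 ug ut.
apply: (@le_trans _ _ (energy p Omega h)).
  by apply: ereal_inf_lbound; exists v, h.
rewrite hE lee_wpmul2r ?energy_ge0// lee_fin.
rewrite powRAC -powRM ?powR_ge0// ?(ltW d0)// !powRN.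
rewrite lef_pV2 ?posrE ?powR_gt0//.
by rewrite ge0_ler_powR// ?nnegrE ?(ltW p0) ?(ltW t0) ?(ltW da0).
Qed.

End lambda_bounds.

Lemma cvg_powR_inv (R : realType) (c : R) : 0 < c ->
  c `^ q^-1 @[q --> +oo] --> (1 : R).
Proof.
move=> c0; rewrite (_ : (fun q => c `^ q^-1) = (fun q => expR (q^-1 * ln c))).
  rewrite -expR0 -(mul0r (ln c)); apply: cvg_comp; last exact: continuous_expR.
  apply: cvgMr_tmp; apply/cvgrVy.
    by near=> q; rewrite invr_gt0; near: q; exact: nbhs_pinfty_gt.
  rewrite [X in X @ _](_ : _ = id); first exact: cvg_id.
  by apply/funext => q /=; rewrite invrK.
by apply/funext => q; rewrite /powR gt_eqF.
Unshelve. all: by end_near. Qed.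

Lemma lambda_cvg (R : realType) (N : nat) (Omega : set 'rV[R]_N) (p : R) :
  (0 < N)%N -> open Omega -> bounded_set Omega -> N%:R < p ->
  lambda p Omega q @[q --> +oo%R] --> lambda_infty Omega p.
Proof.
move=> N0 oO bO Np.
have Ooo : (lebesgue_rV R N Omega < +oo)%E.
  by apply: bounded_lebesgue_rV_lty => //; exact: open_measurable_rV.
(* Adding 1 makes V positive at once; the factor it produces tends to 1 anyway. *)
pose V := fine (lebesgue_rV R N Omega) + 1.
have V0 : 0 < V by rewrite ltr_wpDl// fine_ge0.
have OV : (lebesgue_rV R N Omega <= V%:E)%E.
  by rewrite EFinD fineK ?leeDl// ge0_fin_numE.
have lower := lambda_ge N0 oO bO Np V0 OV.
have cV := cvg_powR_inv (powR_gt0 (- p) V0).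
(* If the infimum is infinite, the lower bound makes [lambda p Omega q] infinite for every q > 0. *)
have := lambda_infty_ge0 Omega p; case EM : lambda_infty => [r| |]// r0; last first.
  apply: cvg_near_cst; near=> q.
  have q0 : 0 < q by near: q; exact: nbhs_pinfty_gt.
  have := lower q q0; rewrite EM gt0_muley ?lte_fin ?powR_gt0//.
  by rewrite leye_eq => /eqP.
rewrite lee_fin in r0.
have above e : 0 < e -> \forall q \near +oo, (lambda p Omega q < (r + e)%:E)%E.
  move=> e0.
  have : (lambda_infty Omega p < (r + e)%:E)%E by rewrite EM lte_fin ltrDl.
  move=> /ereal_inf_lt[_ [u [g [ug u1 ->]]] gre].
  have : energy p Omega g \is a fin_num.
    by rewrite ge0_fin_numE ?energy_ge0// (lt_trans gre)// ltry.
  have := energy_ge0 Omega p g; move: gre.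
  case gE : energy => [E| |]//; rewrite lte_fin lee_fin => Ere E0 _.
  have re0 : 0 < r + e by exact: le_lt_trans Ere.
  (* The midpoint of E/(r+e) and 1. With d = k^(1/p) one has d^(-p) = 1/k, and E/k < r + e leaves
     room for the factor c^(1/q). *)
  pose k := (E / (r + e) + 1) / 2.
  have Er1 : E / (r + e) < 1 by rewrite ltr_pdivrMr// mul1r.
  have Er0 : 0 <= E / (r + e) by rewrite divr_ge0// ltW.
  have k0 : 0 < k by rewrite /k; lra.
  have k1 : k < 1 by rewrite /k; lra.
  have p0 : 0 < p by rewrite (le_lt_trans _ Np).
  have kE : (k `^ p^-1) `^ (- p) = k^-1.
    by rewrite powRN -powRrM mulVf ?gt_eqF// powRr1// ltW.
  have d01 : 0 < k `^ p^-1 < 1.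
    rewrite powR_gt0//=.
    have := @gt0_ltr_powR R p^-1 _ k 1; rewrite powR1 invr_gt0 !nnegrE.
    by apply => //; exact: ltW.
  have [c c0 /= hc] := lambda_le oO bO Np d01 ug u1.
  have lim1 : (k^-1 * c `^ q^-1) * E @[q --> +oo] --> (k^-1 * 1) * E.
    by apply: cvgMr_tmp; apply: cvgMl_tmp; exact: cvg_powR_inv.
  have kEre : (k^-1 * 1) * E < r + e.
    rewrite mulr1 mulrC ltr_pdivrMr// mulrC -ltr_pdivrMr//.
    by rewrite /k; lra.
  near=> q.
  have q0 : 0 < q by near: q; exact: nbhs_pinfty_gt.
  apply: le_lt_trans (hc q q0) _; rewrite gE kE -EFinM lte_fin.
  by near: q; exact: cvgr_lt lim1 _ kEre.
have below e : 0 < e -> \forall q \near +oo, ((r - e)%:E < lambda p Omega q)%E.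
  move=> e0.
  have lim1 : (V `^ (- p)) `^ q^-1 * r @[q --> +oo] --> 1 * r.
    exact: cvgMr_tmp.
  near=> q.
  have q0 : 0 < q by near: q; exact: nbhs_pinfty_gt.
  apply: lt_le_trans (lower q q0); rewrite EM -EFinM lte_fin.
  near: q; apply: cvgr_gt lim1 _ _.
  by rewrite mul1r gtrBl.
(* Convergence in the extended reals to a finite limit: the values are eventually finite, lying
   between r - 1 and r + 1, and their real parts converge. *)
apply/fine_cvgP; split.
  near=> q; rewrite fin_numElt.
  rewrite (@lt_trans _ _ (r - 1)%:E) ?ltNyr//=; last by near: q; exact: below.
  rewrite (@lt_trans _ _ (r + 1)%:E) ?ltry//; last by near: q; exact: above.
apply/cvgrPdist_lt => e e0; near=> q => /=.
have : ((r - e)%:E < lambda p Omega q)%E by near: q; exact: below.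
have : (lambda p Omega q < (r + e)%:E)%E by near: q; exact: above.
case: (lambda p Omega q) => [l| |]//; rewrite !lte_fin /= => h1 h2.
by rewrite ltr_norml; lra.
Unshelve. all: by end_near. Qed.

Theorem theorem2p1 (R : realType) (N : nat) (Omega : set 'rV[R]_N) (p : R) :
  (2 <= N)%N -> domain Omega -> bounded_set Omega -> smooth_boundary Omega ->
  N%:R < p ->
  cvg (lambda p Omega q @[q --> +oo%R]) /\
  Lambda p Omega =
    ereal_inf [set E | exists u g, [/\ sobolev0 p Omega u g,
      Lp_norm Omega +oo%E u = 1%E & E = energy p Omega g]].
Proof.
move=> N2 [_ oO _] bO _ Np.
have cl := lambda_cvg (ltnW N2) oO bO Np.
split; first by apply/cvg_ex; exists (lambda_infty Omega p).
exact: cvg_lim cl.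
Qed.
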